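(* Let $G$ be an abelian group. Let $\mathcal{H}$ and $\mathcal{H}'$ be two hypergraphs such that for any $\sigma\in\mathcal{H}$ and any $\sigma'\in\mathcal{H}'$, either $\sigma\cap\sigma'$ is empty or $\sigma\cap\sigma'\in\mathcal{H}\cap\mathcal{H}'$. Let $d$ be a distance function on the vertex set of $\mathcal{H}\cup\mathcal{H}'$. Then for any $0<r_1<r_2<\cdots<r_k<\cdots$ there is a commutative diagram of embedded homology groups (with coefficients in $G$) whose rows are the long exact sequences $$\cdots\to H_n(\mathcal{H}(r_k)\cap\mathcal{H}'(r_k))\to H_n(\mathcal{H}(r_k))\oplus H_n(\mathcal{H}'(r_k))\to H_n(\mathcal{H}(r_k)\cup\mathcal{H}'(r_k))\to H_{n-1}(\mathcal{H}(r_k)\cap\mathcal{H}'(r_k))\to\cdots$$ for $k=1,2,\ldots$, together with a final row $$\cdots\to H_n(\mathcal{H}\cap\mathcal{H}')\to H_n(\mathcal{H})\oplus H_n(\mathcal{H}')\to H_n(\mathcal{H}\cup\mathcal{H}')\to H_{n-1}(\mathcal{H}\cap\mathcal{H}')\to\cdots,$$ and whose vertical maps, from the row of $r_k$ to the row of $r_{k+1}$ and from the row of each $r_k$ to the final row, are the homomorphisms induced by the inclusions of hypergraphs. That is, every row is exact and all squares commute.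
   Context: All hypergraphs live on finite totally ordered vertex sets; $\mathcal{H}$ and $\mathcal{H}'$ are on subsets of a common finite totally ordered set. A hypergraph $\mathcal{H}$ is a set of non-empty subsets (called hyperedges) of its vertex set $V_{\mathcal{H}}$, where $V_{\mathcal{H}}$ is the union of the hyperedges. Unions and intersections of hypergraphs are unions and intersections of their sets of hyperedges. An $n$-hyperedge is a hyperedge with $n+1$ elements, and $\mathcal{H}_n$ is the set of $n$-hyperedges. A simplicial complex is a hypergraph closed under taking non-empty subsets of hyperedges. The associated simplicial complex $K_{\mathcal{H}}$ consists of all non-empty subsets of hyperedges of $\mathcal{H}$. Given a distance function $d$ on (a set containing) $V_{\mathcal{H}}$ and $r>0$, let $K(\mathcal{H},r)$ be the simplicial complex of all non-empty sets $\{v_0,\ldots,v_n\}\subseteq V_{\mathcal{H}}$ with $d(v_i,v_j)<r$ for all $i,j$, and let $\mathcal{H}(r)=\mathcal{H}\cap K(\mathcal{H},r)$. Likewise $\mathcal{H}'(r)=\mathcal{H}'\cap K(\mathcal{H}',r)$. For $r\le s$, $\mathcal{H}(r)\subseteq\mathcal{H}(s)\subseteq\mathcal{H}$. For a finite set $S$, $G(S)$ is the group of formal linear combinations of elements of $S$ with coefficients in $G$ ($G(\emptyset)=0$). For a simplicial complex $K$, the groups $G(K_n)$, $n\ge 0$, form a chain complex with boundary $\partial_n\{v_0\prec\cdots\prec v_n\}=\sum_{i=0}^n(-1)^i\{v_0,\ldots,\hat v_i,\ldots,v_n\}$ for $n\geq 1$ and $\partial_0=0$. For a graded subgroup $D_*$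 of a chain complex $C_*$, the infimum chain complex is $\mathrm{Inf}_n(D_*,C_* )=\sum\{C'_n\mid C'_* \text{ a subchain complex of } C_* \text{ with } C'_k\subseteq D_k \text{ for all } k\}$. Put $\mathrm{Inf}_*(\mathcal{H})=\mathrm{Inf}_*(G(\mathcal{H}_* ),G((K_{\mathcal{H}})_* ))$. The $n$-th embedded homology of $\mathcal{H}$ is $H_n(\mathcal{H})=H_n(\mathrm{Inf}_*(\mathcal{H}))$. An inclusion of hypergraphs $\mathcal{A}\subseteq\mathcal{B}$ induces an inclusion of chain complexes $\mathrm{Inf}_*(\mathcal{A})\subseteq\mathrm{Inf}_*(\mathcal{B})$ and hence a homomorphism $H_n(\mathcal{A})\to H_n(\mathcal{B})$. The rows are Mayer-Vietoris sequences: for a pair $(\mathcal{A},\mathcal{B})$, the map $H_n(\mathcal{A}\cap\mathcal{B})\to H_n(\mathcal{A})\oplus H_n(\mathcal{B})$ is induced by the inclusions (with a sign on one component) and $H_n(\mathcal{A})\oplus H_n(\mathcal{B})\to H_n(\mathcal{A}\cup\mathcal{B})$ is induced by the sum of the inclusions. *)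

(* Defs.v *)
From HB Require Import structures.
From mathcomp Require Import all_boot all_order all_algebra.
From mathcomp Require Import boolp reals.

Set Implicit Arguments.
Unset Strict Implicit.
Unset Printing Implicit Defensive.

Import Order.TTheory GRing.Theory Num.Theory.
Import Quotient.

Local Open Scope ring_scope.

(* A hypergraph on (a subset of) V is a set of non-empty subsets of V; its
   vertex set V_H is [cover H], the union of the hyperedges. *)
Section Hypergraphs.
Variables (disp : Order.disp_t) (V : finOrderType disp).
Implicit Types A B H : {set {set V}}.

Definition hypergraph H : bool := set0 \notin H.

Definition hyperedges H (n : nat) : {set {set V}} := [set s in H | #|s| == n.+1].

(* K_H *)
Definition assoc_complex H : {set {set V}} :=
  [set s | (s != set0) && [exists t in H, s \subset t]].

Lemma assoc_complexS A B : A \subset B -> assoc_complex A \subset assoc_complex B.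
Proof.
move=> AB; apply/subsetP => s; rewrite !inE => /andP[-> /exists_inP[t tA st]].
by apply/exists_inP; exists t => //; apply: (subsetP AB).
Qed.

Lemma hyperedgesS A B n : A \subset B -> hyperedges A n \subset hyperedges B n.
Proof.
by move=> AB; apply/subsetP => s; rewrite !inE => /andP[/(subsetP AB)-> ->].
Qed.

Section Filtration.
Variables (R : realType) (d : V -> V -> R).

Definition distance_on (A : {set V}) : Prop :=
  [/\ {in A &, forall u v, 0 <= d u v},
      {in A &, forall u v, d u v = 0 <-> u = v},
      {in A &, forall u v, d u v = d v u}
    & {in A & &, forall u v w, d u w <= d u v + d v w}].

(* K(H, r) *)
Definition rips_complex H (r : R) : {set {set V}} :=
  [set s | [&& s != set0, s \subset cover H
             & [forall u in s, forall v in s, d u v < r]]].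

(* H(r) *)
Definition sublevel H (r : R) : {set {set V}} := H :&: rips_complex H r.

Lemma sublevel_sub H r : sublevel H r \subset H.
Proof. exact: subsetIl. Qed.

Lemma sublevelS H r s : r <= s -> sublevel H r \subset sublevel H s.
Proof.
move=> rs; apply: setIS; apply/subsetP => t; rewrite !inE => /and3P[-> -> /=].
move=> /forall_inP dr; apply/forall_inP => u ut; apply/forall_inP => v vt.
by move: (dr u ut) => /forall_inP/(_ v vt)/lt_le_trans; apply.
Qed.

End Filtration.
End Hypergraphs.

(* All the chain groups G(K_n) live in the group of G-valued functions on the
   finite subsets of V, that is, of formal sums of subsets of V; G(S) is the
   subgroup of the functions supported in S. *)
Section Chains.
Variables (disp : Order.disp_t) (V : finOrderType disp) (G : zmodType).

Definition chain := {ffun {set V} -> G}.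
HB.instance Definition _ := GRing.Zmodule.on chain.

Definition formal_sums (S : {set {set V}}) : {pred chain} :=
  [pred x : chain | support x \subset S].

Lemma formal_sumsP (S : {set {set V}}) (x : chain) :
  reflect (forall s, s \notin S -> x s = 0) (x \in formal_sums S).
Proof.
apply: (iffP subsetP) => [xS s|xS s]; last first.
  by rewrite inE; apply: contra_neqT => /xS.
by apply: contraNeq => xs; apply: xS; rewrite inE.
Qed.

Lemma formal_sumsS (S T : {set {set V}}) :
  S \subset T -> {subset formal_sums S <= formal_sums T}.
Proof. by move=> ST x xS; apply: subset_trans xS ST. Qed.

(* the formal sum g s *)
Definition simplex (g : G) (s : {set V}) : chain :=
  [ffun t => if t == s then g else 0].

(* In s = {v_0 < ... < v_n} the vertex v_i is the one with i elements of s
   below it. *)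
Definition vertex_index (s : {set V}) (v : V) : nat :=
  #|[set u in s | (u < v)%O]|.

Definition boundary (n : nat) (x : chain) : chain :=
  if n is 0 then 0 else
  \sum_(s : {set V} | #|s| == n.+1)
    \sum_(v in s) simplex (x s *~ (-1) ^+ vertex_index s v) (s :\ v).

Fact boundary_is_zmod_morphism n : zmod_morphism (boundary n).
Proof.
case: n => [|n] x y /=; first by rewrite subr0.
rewrite -sumrB; apply: eq_bigr => s _; rewrite -sumrB; apply: eq_bigr => v _.
apply/ffunP => t; rewrite !ffunE; case: ifP => _; last by rewrite subr0.
by rewrite mulrzBl.
Qed.
HB.instance Definition _ n :=
  GRing.isZmodMorphism.Build chain chain (boundary n)
    (boundary_is_zmod_morphism n).
Arguments boundary : simpl never.

(* Graded subgroups and chain complexes inside [chain]; the degree 0 boundary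
   vanishes, so only the positive degrees matter in the last condition. *)
Definition subchain_complex (C' C : nat -> {pred chain}) : Prop :=
  [/\ forall n, zmod_closed (C' n),
      forall n, {subset C' n <= C n}
    & forall n x, x \in C' n.+1 -> boundary n.+1 x \in C' n].

(* The sum of the C'_n over the subchain complexes C' of C contained in D:
   the set of all finite sums of elements of these C'_n. *)
Definition infimum (D C : nat -> {pred chain}) (n : nat) : {pred chain} :=
  fun x => `[< exists2 s : seq chain, x = \sum_(y <- s) y
    & {in s, forall y, exists C' : nat -> {pred chain},
        [/\ subchain_complex C' C, forall k, {subset C' k <= D k}
          & y \in C' n]} >].

Definition infimum_complex (H : {set {set V}}) : nat -> {pred chain} :=
  infimum (fun n => formal_sums (hyperedges H n))
          (fun n => formal_sums (hyperedges (assoc_complex H) n)).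

Lemma infimum_zmod_closed D C n : zmod_closed (infimum D C n).
Proof.
split=> [|x y]; first by apply/asboolP; exists [::]; rewrite ?big_nil.
move=> /asboolP[s -> sC] /asboolP[t -> tC]; apply/asboolP.
exists (s ++ map -%R t); first by rewrite big_cat big_map sumrN.
move=> z; rewrite mem_cat => /orP[/sC//|/mapP[y' /tC[C' [subC CD y'C]] ->]].
exists C'; split=> //; have [/(_ n) [z0 zB] _ _] := subC.
by rewrite -sub0r; apply: zB.
Qed.

Lemma infimum_complex_zmod_closed (H : {set {set V}}) n : zmod_closed (infimum_complex H n).
Proof. exact: infimum_zmod_closed. Qed.

Lemma infimum_complexS (A B : {set {set V}}) n :
  A \subset B -> {subset infimum_complex A n <= infimum_complex B n}.
Proof.
move=> AB x /asboolP[s -> sC]; apply/asboolP; exists s => // y /sC.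
move=> [C' [[zC CK dC] CD yC]]; exists C'; split=> //.
  split=> // k z /CK; apply: formal_sumsS.
  exact/hyperedgesS/assoc_complexS.
by move=> k z /CD; apply: formal_sumsS; apply: hyperedgesS.
Qed.

End Chains.

Arguments boundary {disp V G} n x : simpl never.
Arguments infimum_complex {disp V} G H n.

(* H_n(H) is the quotient of the group [cycle] of n-cycles of Inf_*(H) by the
   subgroup [boundaries] of the cycles bounding an element of Inf_(n+1)(H). *)
Section Homology.
Variables (disp : Order.disp_t) (V : finOrderType disp) (G : zmodType).
Implicit Types (H : {set {set V}}) (n : nat).

Definition cycles H n : {pred chain V G} :=
  [pred x | (x \in infimum_complex G H n) && (boundary n x == 0)].

Fact cycles_zmod_closed H n : zmod_closed (cycles H n).
Proof.
have [i0 iB] := infimum_complex_zmod_closed G H n.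
split=> [|x y]; rewrite !inE; first by rewrite i0 raddf0 eqxx.
move=> /andP[xi /eqP dx] /andP[yi /eqP dy].
by rewrite raddfB /= dx dy subrr eqxx andbT; apply: iB.
Qed.
HB.instance Definition _ H n :=
  GRing.isZmodClosed.Build (chain V G) (cycles H n) (cycles_zmod_closed H n).

Record cycle H n := Cycle {
  cycle_val :> chain V G;
  cycle_valP : cycle_val \in cycles H n }.
HB.instance Definition _ H n := [isSub for @cycle_val H n].
HB.instance Definition _ H n := [Choice of cycle H n by <:].
HB.instance Definition _ H n := [SubChoice_isSubZmodule of cycle H n by <:].

Definition boundaries H n : {pred cycle H n} :=
  fun x => `[< exists2 y, y \in infimum_complex G H n.+1
                        & boundary n.+1 y = val x >].
Arguments boundaries : clear implicits.

Fact boundaries_zmod_closed H n : zmod_closed (boundaries H n).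
Proof.
have [i0 iB] := infimum_complex_zmod_closed G H n.+1.
split=> [|x y]; first by apply/asboolP; exists 0; rewrite // raddf0.
move=> /asboolP[x' xi dx] /asboolP[y' yi dy]; apply/asboolP.
by exists (x' - y'); [exact: iB | rewrite raddfB /= dx dy].
Qed.
HB.instance Definition _ H n :=
  GRing.isZmodClosed.Build (cycle H n) (boundaries H n)
    (boundaries_zmod_closed H n).

Definition homology H n : zmodType := {quot (boundaries H n)}.

Definition hclass H n (x : cycle H n) : homology H n :=
  (\pi_({quot (boundaries H n)}) x)%qT.

Lemma hclass_is_zmod_morphism H n : zmod_morphism (@hclass H n).
Proof. exact: raddfB. Qed.
HB.instance Definition _ H n :=
  GRing.isZmodMorphism.Build (cycle H n) (homology H n) (@hclass H n)
    (@hclass_is_zmod_morphism H n).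

Definition hrepr H n (x : homology H n) : cycle H n :=
  repr (x : {quot (boundaries H n)}).

Lemma hreprK H n : cancel (@hrepr H n) (@hclass H n).
Proof. exact: reprK. Qed.

Lemma hclass_eq H n (x y : cycle H n) :
  hclass x = hclass y <-> x - y \in boundaries H n.
Proof. by rewrite idealrBE; split=> /eqP. Qed.

End Homology.

Arguments cycles {disp V} G H n.
Arguments boundaries {disp V} G H n.

Section Induced.
Variables (disp : Order.disp_t) (V : finOrderType disp) (G : zmodType).
Variables (A B : {set {set V}}) (AB : A \subset B) (n : nat).

Fact cycle_incl_subproof (x : cycle G A n) : val x \in cycles G B n.
Proof.
have /andP[xA dx] := cycle_valP x.
by apply/andP; split=> //; apply: infimum_complexS xA.
Qed.

Definition cycle_incl (x : cycle G A n) : cycle G B n :=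
  Cycle (cycle_incl_subproof x).

Definition induced (x : homology G A n) : homology G B n :=
  hclass (cycle_incl (hrepr x)).

Lemma cycle_incl_is_zmod_morphism : zmod_morphism cycle_incl.
Proof. by move=> x y; apply: val_inj. Qed.
HB.instance Definition _ :=
  GRing.isZmodMorphism.Build (cycle G A n) (cycle G B n) cycle_incl
    cycle_incl_is_zmod_morphism.

Lemma induced_hclass (x : cycle G A n) :
  induced (hclass x) = hclass (cycle_incl x).
Proof.
apply/hclass_eq; rewrite -raddfB.
have /hclass_eq/asboolP[y yA dy] := hreprK (hclass x).
by apply/asboolP; exists y; first exact: infimum_complexS yA.
Qed.

Lemma induced_is_zmod_morphism : zmod_morphism induced.
Proof.
move=> x y; rewrite -[x]hreprK -[y]hreprK -raddfB.
by rewrite !induced_hclass !raddfB.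
Qed.
HB.instance Definition _ :=
  GRing.isZmodMorphism.Build (homology G A n) (homology G B n) induced
    induced_is_zmod_morphism.

End Induced.

Arguments induced {disp V} G {A B} AB n x.

Lemma induced_comp (disp : Order.disp_t) (V : finOrderType disp)
    (G : zmodType) (A B C : {set {set V}})
    (AB : A \subset B) (BC : B \subset C) (AC : A \subset C) n x :
  induced G BC n (induced G AB n x) = induced G AC n x.
Proof.
by rewrite -[x]hreprK !induced_hclass; congr hclass; apply: val_inj.
Qed.

Section MayerVietoris.
Variables (disp : Order.disp_t) (V : finOrderType disp) (G : zmodType).
Implicit Types A B : {set {set V}}.

Definition exact_at (X Y Z : zmodType) (f : X -> Y) (g : Y -> Z) : Prop :=
  forall y, g y = 0 <-> exists x, f x = y.

Definition mv_diff A B n (x : homology G (A :&: B) n) :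
    homology G A n * homology G B n :=
  (induced G (subsetIl A B) n x, - induced G (subsetIr A B) n x).

Definition mv_sum A B n (x : homology G A n * homology G B n) :
    homology G (A :|: B) n :=
  induced G (subsetUl A B) n x.1 + induced G (subsetUr A B) n x.2.

Definition induced2 A B A' B' (sA : A \subset A') (sB : B \subset B') n
    (x : homology G A n * homology G B n) : homology G A' n * homology G B' n :=
  (induced G sA n x.1, induced G sB n x.2).

Definition connecting_family A B :=
  forall n, {additive homology G (A :|: B) n.+1 -> homology G (A :&: B) n}.

(* delta is the Mayer-Vietoris connecting homomorphism: a class [z] with
   z = a + b, a and b chains of Inf_*(A) and Inf_*(B), is sent to the class of
   the boundary of a (which is that of - b). *)
Definition is_connecting A B (delta : connecting_family A B) : Prop :=
  forall n (z : cycle G (A :|: B) n.+1) (a b : chain V G)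
         (c : cycle G (A :&: B) n),
    a \in infimum_complex G A n.+1 -> b \in infimum_complex G B n.+1 ->
    val z = a + b -> val c = boundary n.+1 a ->
    delta n (hclass z) = hclass c.

(* Homology vanishes in negative degrees, so the sequence ends with
   ... -> H_0(A) + H_0(B) -> H_0(A u B) -> 0. *)
Definition mv_exact A B (delta : connecting_family A B) : Prop :=
  [/\ forall n, exact_at (@mv_diff A B n) (@mv_sum A B n),
      forall n, exact_at (@mv_sum A B n.+1) (delta n),
      forall n, exact_at (delta n) (@mv_diff A B n)
    & forall z, exists x, @mv_sum A B 0 x = z].

Definition mv_row A B (delta : connecting_family A B) : Prop :=
  is_connecting delta /\ mv_exact delta.

Definition mv_commute A B A' B' (sA : A \subset A') (sB : B \subset B')
    (delta : connecting_family A B) (delta' : connecting_family A' B') : Prop :=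
  [/\ forall n x, mv_diff (induced G (setISS sA sB) n x) =
                  induced2 sA sB (mv_diff x),
      forall n x, mv_sum (induced2 sA sB x) =
                  induced G (setUSS sA sB) n (mv_sum x)
    & forall n x, delta' n (induced G (setUSS sA sB) n.+1 x) =
                  induced G (setISS sA sB) n (delta n x)].

End MayerVietoris.

(* Main.v *)
(* As the boundary squares to zero, [Inf_n(A)] consists of the chains of
   [G(A_n)] with boundary in [G(A_(n-1))]; hence Inf_*(A n B) is the
   intersection of Inf_*(A) and Inf_*(B). The hypothesis on intersections of
   hyperedges makes Inf_*(A u B) their sum, by splitting a chain into its part
   on A and the rest, so that the Mayer-Vietoris sequence is the long exact
   sequence of a short exact sequence of chain complexes. The hypothesis passes
   to sublevels because a subset of a hyperedge has no larger distances.
   The connecting map is natural since inclusions preserve the splittings that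
   characterize it. *)

From HB Require Import structures.
From mathcomp Require Import all_boot all_order all_algebra.
From mathcomp Require Import boolp reals.
Require Import Defs.

Set Implicit Arguments.
Unset Strict Implicit.
Unset Printing Implicit Defensive.

Import Order.TTheory GRing.Theory Num.Theory.
Local Open Scope ring_scope.

(** * The boundary operator and its square *)

Section Boundary.
Variables (disp : Order.disp_t) (V : finOrderType disp) (G : zmodType).
Implicit Types (x : chain V G) (s t : {set V}) (v w : V).

(** A pair [(s, v)] with [v] in [s] contributes to the coefficient of [t] exactly when [v] is
    outside [t] and [s = v |: t], so the double sum collapses to a sum over the added vertex. *)
Lemma boundaryE n x t :
  boundary n.+1 x t =
  if #|t| == n.+1 then
    \sum_(v | v \notin t) x (v |: t) *~ (-1) ^+ vertex_index (v |: t) v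
  else 0.
Proof.
rewrite /boundary sum_ffunE.
under eq_bigr => s sn.
  rewrite sum_ffunE; under eq_bigr => v vs do rewrite ffunE.
  over.
rewrite (exchange_big_dep predT) //=; have [tn|tn] := eqVneq; last first.
  rewrite big1 // => v _; rewrite big1 // => s /andP[/eqP sn vs].
  rewrite ifN //; apply: contra_neq tn => ->.
  by move: sn; rewrite (cardsD1 v) vs => -[].
rewrite [RHS]big_mkcond; apply: eq_bigr => v _ /=; case: ifPn => vt; last first.
  rewrite big1 // => s /andP[_ vs]; rewrite ifN //.
  by apply: contraNneq vt => ->; rewrite setD11.
rewrite (bigD1 (v |: t)) /=; last by rewrite cardsU1 vt tn setU11 eqxx.
rewrite setU1K // eqxx big1 ?addr0 // => s /andP[/andP[_ vs] svt].
by rewrite ifN //; apply: contra_neq svt => ->; rewrite setD1K.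
Qed.

Lemma vertex_indexU1 t v w :
  v \notin t ->
  vertex_index (v |: t) w = ((v < w)%O + vertex_index t w)%N.
Proof.
move=> vt; rewrite /vertex_index; case: ltP => vw /=.
  rewrite (cardsD1 v) !inE eqxx vw; congr (_ + _)%N; apply: eq_card => u.
  by rewrite !inE; case: eqVneq => [->|]; rewrite ?(negbTE vt).
rewrite add0n; apply: eq_card => u; rewrite !inE.
by case: eqVneq => [->|]//; rewrite ltNge vw !andbF.
Qed.

Lemma boundary_boundary n x : boundary n (boundary n.+1 x) = 0.
Proof.
case: n => [//|n]; apply/ffunP => t; rewrite boundaryE ffunE.
case: eqP => // tn.
(* [F v w] is the contribution of adding first [v], then [w], to [t], extended by zero to all pairs
   so that it becomes antisymmetric. *)
pose F v w := if [&& v \notin t, w \notin t & v != w] then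
  x (w |: (v |: t)) *~ (-1) ^+ ((v < w)%O + vertex_index t v + vertex_index t w)
  else 0.
(* For [v != w] exactly one of [v < w] and [w < v] holds, so the two exponents differ by one. *)
have FN v w : F w v = - F v w.
  rewrite /F eq_sym andbCA; case: ifP => [/and3P[vt wt vw]|_]; last by rewrite oppr0.
  rewrite setUCA -mulrNz -!addnA [(_ t w + _)%N]addnC; congr (_ *~ _).
  by case: ltgtP vw => //= _ _; rewrite add0n add1n exprS mulN1r ?opprK.
transitivity (\sum_v \sum_w F v w).
  rewrite big_mkcond; apply: eq_bigr => v _; rewrite /F.
  case: ifP => vt /=; last by rewrite big1.
  rewrite boundaryE cardsU1 vt tn eqxx mulrz_suml big_mkcond.
  apply: eq_bigr => w _; rewrite !inE negb_or andbC eq_sym.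
  case: ifP => [/andP[wt vw]|] //.
  rewrite -mulrzA -exprD !vertex_indexU1 ?inE ?negb_or ?wt 1?eq_sym ?vw //.
  by rewrite !ltxx !add0n addnAC.
(* The diagonal vanishes, and swapping coordinates matches the pairs above it with those below. *)
rewrite pair_big (bigID (fun p : V * V => (p.1 < p.2)%O)) /=.
rewrite [X in _ + X](bigID (fun p : V * V => p.1 == p.2)) /=.
rewrite [X in _ + (X + _)]big1 ?add0r; last first.
  by move=> [v w] /= /andP[_ /eqP->]; rewrite /F eqxx !andbF.
rewrite [X in _ + X](reindex (fun p : V * V => (p.2, p.1))) /=; last first.
  by exists (fun p => (p.2, p.1)) => -[].
apply/eqP; rewrite addr_eq0 -sumrN; apply/eqP; apply: eq_big => [[v w]|[v w] _] /=.
  by case: ltgtP.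
exact: FN.
Qed.

End Boundary.

(** * The infimum complex and its behaviour under intersections *)

Section Infimum.
Variables (disp : Order.disp_t) (V : finOrderType disp) (G : zmodType).
Implicit Types (A B : {set {set V}}) (x y : chain V G).

HB.instance Definition _ A n :=
  GRing.isZmodClosed.Build (chain V G) (infimum_complex G A n)
    (infimum_complex_zmod_closed G A n).

Local Notation formal_sums := (@formal_sums disp V G).

Lemma formal_sums_zmod_closed A : zmod_closed (formal_sums A).
Proof.
split=> [|x y]; first by apply/formal_sumsP => s _; rewrite ffunE.
move=> /formal_sumsP xA /formal_sumsP yA; apply/formal_sumsP => s sA.
by rewrite !ffunE xA // yA // subr0.
Qed.
HB.instance Definition _ A :=
  GRing.isZmodClosed.Build (chain V G) (formal_sums A)
    (formal_sums_zmod_closed A).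

Lemma hyperedges_assoc_complex A n :
  hyperedges A n \subset hyperedges (assoc_complex A) n.
Proof.
apply/subsetP => s; rewrite !inE => /andP[sA /eqP sn]; rewrite sn eqxx andbT.
by rewrite -card_gt0 sn; apply/exists_inP; exists s.
Qed.

Lemma infimum_complexP A n x :
  (x \in infimum_complex G A n) =
  (x \in formal_sums (hyperedges A n)) &&
  (boundary n x \in formal_sums (hyperedges A n.-1)).
Proof.
pose D k := formal_sums (hyperedges A k).
apply/idP/andP => [/asboolP[s -> sC]|[xA dxA]].
  rewrite raddf_sum /=; split; rewrite big_seq; apply: rpred_sum => y.
    by move=> /sC[C' [_ CD yC]]; apply: CD.
  move=> /sC[C' [[_ _ dC] CD yC]]; case: n yC {sC} => [|n] yC.
    exact: rpred0.
  exact/CD/dC.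
apply/asboolP; exists [:: x]; first by rewrite big_seq1.
move=> _ /[1!inE] /eqP->.
exists (fun k y => (y \in D k) && (boundary k y \in D k.-1)).
split; last exact/andP.
  split=> [k|k y /andP[+ _]|k y /andP[_ dy]].
  - split=> [|y z]; first by apply/andP; rewrite raddf0 !rpred0.
    move=> /andP[yD dyD] /andP[zD dzD]; apply/andP.
    by rewrite raddfB !rpredB.
  - exact/formal_sumsS/hyperedges_assoc_complex.
  - by apply/andP; rewrite dy boundary_boundary rpred0.
by move=> k y /andP[].
Qed.

Lemma boundary_infimum A n x :
  x \in infimum_complex G A n.+1 -> boundary n.+1 x \in infimum_complex G A n.
Proof.
by rewrite !infimum_complexP boundary_boundary rpred0 andbT => /andP[].
Qed.

Lemma hyperedgesI A B n : hyperedges (A :&: B) n = hyperedges A n :&: hyperedges B n.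
Proof. by apply/setP => s; rewrite !inE andbACA andbb. Qed.

Lemma formal_sumsI A B x :
  (x \in formal_sums (A :&: B)) =
  (x \in formal_sums A) && (x \in formal_sums B).
Proof.
apply/idP/andP => [xAB|[/formal_sumsP xA /formal_sumsP xB]].
  by split; move: xAB; apply: formal_sumsS; rewrite ?subsetIl ?subsetIr.
apply/formal_sumsP => s; rewrite inE negb_and => /orP[]; first exact: xA.
exact: xB.
Qed.

Lemma infimum_complexI A B n x :
  (x \in infimum_complex G (A :&: B) n) =
  (x \in infimum_complex G A n) && (x \in infimum_complex G B n).
Proof. by rewrite !infimum_complexP !hyperedgesI !formal_sumsI andbACA. Qed.

(** * Splitting a chain over a union of hypergraphs *)

Definition restr A x : chain V G := [ffun s => if s \in A then x s else 0].

Fact restr_is_zmod_morphism A : zmod_morphism (restr A).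
Proof.
by move=> x y; apply/ffunP => s; rewrite !ffunE; case: ifP => // _; rewrite subr0.
Qed.
HB.instance Definition _ A :=
  GRing.isZmodMorphism.Build (chain V G) (chain V G) (restr A)
    (restr_is_zmod_morphism A).

Definition intersecting A B : Prop := forall s t : {set V},
  s \in A -> t \in B -> s :&: t = set0 \/ s :&: t \in A :&: B.

Lemma boundary_support n x t :
  boundary n.+1 x t != 0 -> #|t| = n.+1 /\ exists2 v, v \notin t & x (v |: t) != 0.
Proof.
rewrite boundaryE; case: (#|t| =P _) => [tn|_]; last by rewrite eqxx.
move=> dxt; split=> //; case: (pickP [pred v | (v \notin t) && (x (v |: t) != 0)]).
  by move=> v /andP[vt xvt]; exists v.
move=> x0; case/eqP: dxt; apply: big1 => v vt.
by have /negbT := x0 v; rewrite /= vt negbK => /eqP->; rewrite mul0rz.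
Qed.

(* A facet [t] of a hyperedge of [A] that is missing from [A] cannot lie in
   [B], since its intersection with that hyperedge is [t] itself; so it has
   to cancel against a facet of a hyperedge of [B] outside of [A], and [t] is
   then the intersection of these two distinct hyperedges. *)
Lemma restr_infimum A B n x :
  intersecting A B -> x \in infimum_complex G (A :|: B) n ->
  restr A x \in infimum_complex G A n /\ x - restr A x \in infimum_complex G B n.
Proof.
move=> AB; rewrite !infimum_complexP => /andP[/formal_sumsP xAB /formal_sumsP dx].
set a := restr A x; set b := x - a.
have aA : a \in formal_sums (hyperedges A n).
  apply/formal_sumsP => s; rewrite inE ffunE; case: ifP => //= sA sn.
  by apply: xAB; rewrite !inE sA.
have bE (s : {set V}) : b s = if s \in A then 0 else x s.
  by rewrite !ffunE; case: ifP; rewrite ?subrr ?subr0.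
have bB : b \in formal_sums (hyperedges B n).
  apply/formal_sumsP => s; rewrite inE bE; case: ifP => //= sA sn.
  by apply: xAB; rewrite !inE sA.
case: n xAB dx aA bB => [|n] xAB dx aA bB; first by rewrite aA bB !rpred0.
(* Outside the hyperedges of the union the boundary of [x = a + b] vanishes, so the two
   contributions cancel. *)
have dab (t : {set V}) : t \notin hyperedges (A :|: B) n ->
    boundary n.+1 a t = - boundary n.+1 b t.
  by move=> /dx /eqP; rewrite raddfB !ffunE opprB => /eqP->; rewrite subr0.
have da (t : {set V}) : boundary n.+1 a t != 0 ->
    #|t| = n.+1 /\ exists2 v, v \notin t & v |: t \in A.
  move=> /boundary_support[tn [v vt avt]]; split=> //; exists v => //.
  by apply: contraNT avt => vtA; rewrite ffunE (negbTE vtA).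
(* Since [b] vanishes on [A], the coface found here lies outside [A], hence differs from the one
   given by [da]. *)
have db (t : {set V}) : boundary n.+1 b t != 0 ->
    #|t| = n.+1 /\ exists2 v, v \notin t & v |: t \in B :\: A.
  move=> /boundary_support[tn [v vt bvt]]; split=> //; exists v => //.
  move: bvt; rewrite inE bE; case: ifP => [_|vtA bvt]; first by rewrite eqxx.
  apply: contraNT bvt => vtB; rewrite xAB //.
  by move: vtB; rewrite !inE vtA /= => /negbTE->.
have tvt v (t : {set V}) : t :&: (v |: t) = t by apply/setIidPl/subsetUr.
(* The cardinality of [t] rules out the empty case of [intersecting]. *)
have facetA (t : {set V}) : #|t| = n.+1 -> t \in A ->
    (exists2 v, v \notin t & v |: t \in B :\: A) -> t \in B.
  move=> tn tA [v vt /setDP[vtB _]]; have [|/setIP[]] := AB _ _ tA vtB.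
    by rewrite tvt => t0; rewrite t0 cards0 in tn.
  by rewrite tvt.
have facetB (t : {set V}) : #|t| = n.+1 -> t \in B ->
    (exists2 v, v \notin t & v |: t \in A) -> t \in A.
  move=> tn tB [v vt vtA]; have [|/setIP[]] := AB _ _ vtA tB.
    by rewrite setIC tvt => t0; rewrite t0 cards0 in tn.
  by rewrite setIC tvt.
have dABt (t : {set V}) : t \notin A :|: B -> boundary n.+1 a t = 0.
  move=> tAB; have tABn : t \notin hyperedges (A :|: B) n.
    by rewrite inE (negbTE tAB).
  apply/eqP; apply: contraNT tAB => dat; have [tn [v vt vtA]] := da _ dat.
  have [|_ [w wt /setDP[wtB wtA]]] := db t; first by rewrite -oppr_eq0 -dab.
  have vw : v != w by apply: contraNneq wtA => <-.
  have vwt : (v |: t) :&: (w |: t) = t.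
    apply/setP => u; rewrite !inE; case: eqVneq => [->|_] /=.
      by rewrite (negbTE vw) (negbTE vt).
    by case: (u \in t); rewrite ?orbT ?andbF.
  have [|] := AB _ _ vtA wtB; rewrite vwt; last by case/setIP => tA _; rewrite inE tA.
  by move=> t0; rewrite t0 cards0 in tn.
split; apply/andP; split=> //; apply/formal_sumsP => t tn.
  apply/eqP; apply: contraNT tn => dat; have [tn tA] := da _ dat.
  rewrite inE tn eqxx andbT; case: (boolP (t \in A :|: B)) => [/setUP[]//|/dABt dat0].
    by move=> tB; apply: facetB.
  by rewrite dat0 eqxx in dat.
apply/eqP; apply: contraNT tn => dbt; have [tn tB] := db _ dbt.
rewrite inE tn eqxx andbT; case: (boolP (t \in A :|: B)) => [/setUP[]//|tAB].
  by move=> tA; apply: facetA.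
move: dbt; rewrite -oppr_eq0 -dab ?dABt ?eqxx //.
by rewrite inE (negbTE tAB).
Qed.

End Infimum.

(** * Cycles, homology classes and splittings of cycles *)

Section Cycles.
Variables (disp : Order.disp_t) (V : finOrderType disp) (G : zmodType).
Implicit Types (A B : {set {set V}}).

Lemma cyclesP A n (x : chain V G) :
  reflect (x \in infimum_complex G A n /\ boundary n x = 0) (x \in cycles G A n).
Proof. by apply: (iffP andP) => -[xA /eqP]. Qed.

Lemma cycle_infimum A n (x : cycle G A n) : val x \in infimum_complex G A n.
Proof. by have /cyclesP[] := cycle_valP x. Qed.

Lemma boundary_cycle A n (x : cycle G A n) : boundary n (val x) = 0.
Proof. by have /cyclesP[] := cycle_valP x. Qed.

Lemma homologyP A n (x : homology G A n) : exists y : cycle G A n, x = hclass y.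
Proof. by exists (hrepr x); rewrite hreprK. Qed.

Lemma hclass_eq0 A n (x : cycle G A n) :
  hclass x = 0 <->
  exists2 y, y \in infimum_complex G A n.+1 & boundary n.+1 y = val x.
Proof.
rewrite -(raddf0 (@hclass _ _ G A n)) hclass_eq subr0.
by split=> [/asboolP|xA]; last exact/asboolP.
Qed.

Lemma hclass_eqP A n (x x' : cycle G A n) :
  hclass x = hclass x' <->
  exists2 y, y \in infimum_complex G A n.+1 & boundary n.+1 y = val x - val x'.
Proof. by rewrite hclass_eq; split=> [/asboolP|xA]; last exact/asboolP. Qed.

Lemma infimum_complexU_split A B n (x : chain V G) : intersecting A B ->
  x \in infimum_complex G (A :|: B) n ->
  exists a b, [/\ a \in infimum_complex G A n, b \in infimum_complex G B n
                & x = a + b].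
Proof.
move=> AB /(restr_infimum AB)[aA bB].
by exists (restr A x), (x - restr A x); split; rewrite ?subrKC.
Qed.

(** The boundary of [a] equals minus that of [b], so it lies in the infimum complexes of both [A]
    and [B]. *)
Lemma boundary_summand_cycle A B n (a b : chain V G) :
    a \in infimum_complex G A n.+1 -> b \in infimum_complex G B n.+1 ->
    boundary n.+1 (a + b) = 0 ->
  boundary n.+1 a \in cycles G (A :&: B) n.
Proof.
move=> aA bB /eqP; rewrite raddfD addr_eq0 => /eqP dab; apply/cyclesP; split.
  rewrite infimum_complexI boundary_infimum //=.
  by rewrite dab rpredN boundary_infimum.
exact: boundary_boundary.
Qed.

Lemma cycleU_split A B n (z : cycle G (A :|: B) n.+1) : intersecting A B ->
  exists a b (c : cycle G (A :&: B) n),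
    [/\ a \in infimum_complex G A n.+1, b \in infimum_complex G B n.+1,
        val z = a + b & val c = boundary n.+1 a].
Proof.
move=> AB; have [a [b [aA bB zE]]] := infimum_complexU_split AB (cycle_infimum z).
have cP : boundary n.+1 a \in cycles G (A :&: B) n.
  by apply: boundary_summand_cycle aA bB _; rewrite -zE boundary_cycle.
by exists a, b, (Cycle cP).
Qed.

End Cycles.

(** * The connecting homomorphism *)

Section Connecting.
Variables (disp : Order.disp_t) (V : finOrderType disp) (G : zmodType).
Variables (A B : {set {set V}}) (AB : intersecting A B) (n : nat).

Fact connecting_cycle_subproof (z : cycle G (A :|: B) n.+1) :
  boundary n.+1 (restr A (val z)) \in cycles G (A :&: B) n.
Proof.
have [aA bB] := restr_infimum AB (cycle_infimum z).
by apply: boundary_summand_cycle aA bB _; rewrite subrKC boundary_cycle.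
Qed.

Definition connecting_cycle z : cycle G (A :&: B) n :=
  Cycle (connecting_cycle_subproof z).

Definition connecting (x : homology G (A :|: B) n.+1) : homology G (A :&: B) n :=
  hclass (connecting_cycle (hrepr x)).

(** Independence of the representative and of the splitting: if [z' - z] bounds [ya + yb],
    correcting [a' - a] by the boundary of [ya] gives a chain over [A :&: B] whose boundary is the
    difference of the two cycles. *)
Lemma connecting_hclass (z : cycle G (A :|: B) n.+1) (a b : chain V G)
    (c : cycle G (A :&: B) n) :
  a \in infimum_complex G A n.+1 -> b \in infimum_complex G B n.+1 ->
  val z = a + b -> val c = boundary n.+1 a ->
  connecting (hclass z) = hclass c.
Proof.
move=> aA bB zab cda; set z' := hrepr (hclass z).
have [a'A b'B] := restr_infimum AB (cycle_infimum z').
have /hclass_eqP[y yAB dy] : hclass z' = hclass z by rewrite hreprK.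
have [ya [yb [yaA ybB yE]]] := infimum_complexU_split AB yAB.
set a' := restr A (val z') in a'A b'B *.
have dya : boundary n.+2 ya = val z' - (a + b) - boundary n.+2 yb.
  by rewrite -zab -dy yE raddfD addrK.
(* The left side lies over [A]; the right side lies over [B], as [val z' - a'] is the other summand
   of [z']. *)
have wE : a' - a - boundary n.+2 ya = boundary n.+2 yb - (val z' - a' - b).
  rewrite dya !opprD !opprK [LHS](AC (2*((1*2)*1)) ((2*4)*(6*(3*1*5)))) /=.
  by rewrite addNr add0r.
apply/hclass_eqP; exists (a' - a - boundary n.+2 ya); last first.
  by rewrite !raddfB /= boundary_boundary subr0 cda.
rewrite infimum_complexI; apply/andP; split.
  by rewrite !rpredB // boundary_infimum.
by rewrite wE; apply: rpredB; [exact: boundary_infimum | exact: rpredB].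
Qed.

(** By [connecting_hclass] the class of a difference may be computed from the difference of
    representatives, on which [restr] is additive. *)
Lemma connecting_is_zmod_morphism : zmod_morphism connecting.
Proof.
move=> x y; rewrite -{1}[x]hreprK -{1}[y]hreprK -raddfB -[RHS]raddfB.
have [aA bB] := restr_infimum AB (cycle_infimum (hrepr x - hrepr y)).
apply: connecting_hclass aA bB _ _; first by rewrite subrKC.
by rewrite /= !raddfB.
Qed.
HB.instance Definition _ :=
  GRing.isZmodMorphism.Build _ _ connecting connecting_is_zmod_morphism.

End Connecting.

Arguments connecting {disp V} G {A B} AB n x.

(** * Exactness of the rows, naturality, and passage to sublevels *)

Section MayerVietoris.
Variables (disp : Order.disp_t) (V : finOrderType disp) (G : zmodType).
Implicit Types (A B : {set {set V}}).

Lemma mv_row_connecting A B (AB : intersecting A B) :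
  mv_row (fun n => connecting G AB n : {additive _ -> _}).
Proof.
split=> [n z a b c|]; first exact: connecting_hclass.
split=> [n [u v]|n z|n c|z].
- split=> [|[c <-]]; last first.
    have sI := subset_trans (subsetIl A B) (subsetUl A B).
    by rewrite /mv_sum /= raddfN /= !(induced_comp _ _ sI) subrr.
  have [a ->] := homologyP u; have [b ->] := homologyP v.
  rewrite /mv_sum /= !induced_hclass -raddfD => /hclass_eq0[y yAB /= dy].
  have [ya [yb [yaA ybB yE]]] := infimum_complexU_split AB yAB.
  rewrite yE raddfD /= in dy.
  (* With [a + b] bounding [ya + yb], this common value lies over both [A] and [B]; it is homologous
     to [a] over [A] and to [- b] over [B], matching the sign in [mv_diff]. *)
  have cE : val a - boundary n.+1 ya = boundary n.+1 yb - val b.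
    by apply/eqP; rewrite subr_eq addrAC -subr_eq opprK -dy addrC.
  have cP : val a - boundary n.+1 ya \in cycles G (A :&: B) n.
    apply/cyclesP; split; last first.
      by rewrite raddfB /= boundary_boundary boundary_cycle subr0.
    rewrite infimum_complexI {2}cE.
    by rewrite !rpredB // (boundary_infimum, cycle_infimum).
  exists (hclass (Cycle cP)).
  rewrite /mv_diff !induced_hclass -(raddfN (@hclass _ _ _ _ _)).
  congr pair; apply/hclass_eqP.
    by exists (- ya); rewrite ?rpredN //= raddfN /= addrAC subrr sub0r.
  by exists (- yb); rewrite ?rpredN //= cE raddfN /= opprB addrAC subrr sub0r.
- split=> [|[[u v] <-]]; last first.
    have [a ->] := homologyP u; have [b ->] := homologyP v.
    rewrite /mv_sum /= !induced_hclass -raddfD -(raddf0 (@hclass _ _ G _ n)).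
    (* A sum of cycles is already split, and its first summand has boundary 0. *)
    apply: (connecting_hclass _ (cycle_infimum a) (cycle_infimum b)) => //=.
    by rewrite boundary_cycle.
  have [x ->] := homologyP z.
  have [a [b [c [aA bB xE cE]]]] := cycleU_split x AB.
  have dab : boundary n.+1 (a + b) = 0 by rewrite -xE boundary_cycle.
  rewrite /= (connecting_hclass AB aA bB xE cE) => /hclass_eq0[y].
  rewrite infimum_complexI cE => /andP[yA yB] dy.
  (* As [y] has the same boundary as [a], moving it from [a] to [b] turns both summands into cycles
     without changing their sum. *)
  have ayP : a - y \in cycles G A n.+1.
    by apply/cyclesP; rewrite rpredB // raddfB /= dy subrr.
  have byP : b + y \in cycles G B n.+1.
    by apply/cyclesP; rewrite rpredD // raddfD /= dy addrC -raddfD.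
  exists (hclass (Cycle ayP), hclass (Cycle byP)).
  rewrite /mv_sum /= !induced_hclass -raddfD; congr hclass; apply: val_inj => /=.
  by rewrite xE addrACA addNr addr0.
- split=> [|[z <-]]; last first.
    have [x ->] := homologyP z.
    have [a [b [e [aA bB xE eE]]]] := cycleU_split x AB.
    rewrite /= (connecting_hclass AB aA bB xE eE).
    rewrite /mv_diff !induced_hclass -(raddfN (@hclass _ _ _ _ _)).
    (* The image cycle is bounded by [a] over [A], and its negative by [b] over [B]. *)
    congr pair; apply/hclass_eq0.
      by exists a.
    exists b => //=; apply/eqP; rewrite eE -addr_eq0 addrC -raddfD -xE /=.
    by rewrite boundary_cycle.
  have [x ->] := homologyP c.
  rewrite /mv_diff !induced_hclass -(raddfN (@hclass _ _ _ _ _)).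
  case=> /hclass_eq0[a aA /= da] /hclass_eq0[b bB /= db].
  (* The boundaries of [a] and [b] are [c]'s representative and its negative, so [a + b] is a cycle
     split so as to map to the class of that representative. *)
  have abP : a + b \in cycles G (A :|: B) n.+1.
    apply/cyclesP; split; last by rewrite raddfD /= da db subrr.
    apply: rpredD; first exact: infimum_complexS (subsetUl A B) _ aA.
    exact: infimum_complexS (subsetUr A B) _ bB.
  exists (hclass (Cycle abP)).
  exact: connecting_hclass aA bB _ _.
have [x ->] := homologyP z.
have [a [b [aA bB xE]]] := infimum_complexU_split AB (cycle_infimum x).
(* In degree 0 every chain is a cycle, so the summands need no correction. *)
have aP : a \in cycles G A 0 by apply/cyclesP.
have bP : b \in cycles G B 0 by apply/cyclesP.
exists (hclass (Cycle aP), hclass (Cycle bP)).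
by rewrite /mv_sum /= !induced_hclass -raddfD; congr hclass; apply: val_inj.
Qed.

Lemma mv_commute_connecting A B A' B' (sA : A \subset A') (sB : B \subset B')
    (delta : connecting_family G A B) (delta' : connecting_family G A' B') :
    intersecting A B -> is_connecting delta -> is_connecting delta' ->
  mv_commute sA sB delta delta'.
Proof.
move=> AB cd cd'; split=> n x.
- have sIA := subset_trans (subsetIl A B) sA.
  have sIB := subset_trans (subsetIr A B) sB.
  rewrite /mv_diff /induced2 /= raddfN /=; congr (_, - _).
    by rewrite !(induced_comp _ _ sIA).
  by rewrite !(induced_comp _ _ sIB).
- have sAU := subset_trans sA (subsetUl A' B').
  have sBU := subset_trans sB (subsetUr A' B').
  rewrite /mv_sum /induced2 /= raddfD /=; congr (_ + _).
    by rewrite !(induced_comp _ _ sAU).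
  by rewrite !(induced_comp _ _ sBU).
have [z ->] := homologyP x.
have [a [b [c [aA bB zE cE]]]] := cycleU_split z AB.
(* The splitting of [z] over [A] and [B] is also one over [A'] and [B'], so it computes both
   connecting maps. *)
rewrite (cd _ _ _ _ _ aA bB zE cE) !induced_hclass.
by apply: (cd' n _ a b) => //;
  [exact: infimum_complexS aA | exact: infimum_complexS bB].
Qed.

Lemma intersecting_sublevel A B (R : realType) (d : V -> V -> R) r :
  intersecting A B -> intersecting (sublevel d A r) (sublevel d B r).
Proof.
move=> AB s t /setIP[sA]; rewrite inE => /and3P[_ _ /forall_inP ds] /setIP[tB _].
have [|stAB] := AB s t sA tB; first by left.
have [|st0] := eqVneq (s :&: t) set0; first by left.
have /setIP[stA stB] := stAB; right; rewrite !inE stA stB st0 /=.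
(* Being a hyperedge of both [A] and [B], [s :&: t] lies in both vertex sets; the distance bound
   comes from [s]. *)
rewrite !(bigcup_sup (s :&: t)) //= andbb; apply/forall_inP => u /setIP[us _].
by apply/forall_inP => v /setIP[vs _]; have /forall_inP := ds u us; apply.
Qed.

End MayerVietoris.

Theorem theorem4p1 (G : zmodType) (disp : Order.disp_t) (V : finOrderType disp)
    (H H' : {set {set V}}) (hypH : hypergraph H) (hypH' : hypergraph H')
    (HH' : forall s s' : {set V}, s \in H -> s' \in H' ->
       s :&: s' = set0 \/ s :&: s' \in H :&: H')
    (R : realType) (d : V -> V -> R) (dist_d : distance_on d (cover (H :|: H')))
    (r : nat -> R) (r_gt0 : 0 < r 0%N) (r_incr : forall k, r k < r k.+1) :
  exists (delta : forall k,
            connecting_family G (sublevel d H (r k)) (sublevel d H' (r k)))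
         (delta_oo : connecting_family G H H'),
    [/\ forall k, mv_row (delta k),
        mv_row delta_oo,
        forall k, mv_commute (sublevelS d H (ltW (r_incr k)))
                             (sublevelS d H' (ltW (r_incr k)))
                             (delta k) (delta k.+1)
      & forall k, mv_commute (sublevel_sub d H (r k)) (sublevel_sub d H' (r k))
                             (delta k) delta_oo].
Proof.
have Ir k : intersecting (sublevel d H (r k)) (sublevel d H' (r k)).
  exact: intersecting_sublevel.
exists (fun k n => connecting G (Ir k) n : {additive _ -> _}).
(* [HH'] is [intersecting H H'] up to unfolding. *)
exists (fun n => connecting G HH' n : {additive _ -> _}).
split=> [k||k|k]; try exact: mv_row_connecting.
  by apply: mv_commute_connecting; [exact: Ir | case: (mv_row_connecting G (Ir k))
                                   | case: (mv_row_connecting G (Ir k.+1))].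
by apply: mv_commute_connecting; [exact: Ir | case: (mv_row_connecting G (Ir k))
                                 | case: (mv_row_connecting G HH')].
Qed.
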